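(* Let $A(x)=\sum_{i=0}^nA_ix^i\in\mathcal Q_{m,n}$, so that $A_i=\sigma_iQ_i$ with $\sigma_i\ge0$ and $Q_i^*Q_i=I$. Let $0=h_0<h_1<\dots<h_p=n$ and $s_{h_i},t_{h_i}$ be the quantities associated, as described in the context, with the scalar polynomial $w(x)=\sum_{i=0}^n\sigma_ix^i$. Then any matrix polynomial $B(x)=\sum_{i=0}^n\sigma_iS_ix^i\in\mathcal Q_{m,n}$ with $S_i^*S_i=I$ has \begin{enumerate} \item $m(h_i-h_{i-1})$ eigenvalues in the annulus $\mathcal A(t_{h_{i-1}},s_{h_i})$, for $i=1,\dots,p$; \item no eigenvalues in the inner part of the annulus $\mathcal A(s_{h_i},t_{h_i})$, for $i=0,\dots,p$. \end{enumerate}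
   Context: $\mathcal P_{m,n}$ is the class of matrix polynomials $A(x)=\sum_{i=0}^nA_ix^i$ with $A_i\in\mathbb C^{m\times m}$, $\det A(x)\not\equiv0$, $A_n\ne0$, $A_0\neq 0$. $\mathcal Q_{m,n}\subset\mathcal P_{m,n}$ consists of those with $A_i=\sigma_iQ_i$, $Q_i^*Q_i=I$, $\sigma_i\geq0$ for all $i$. Eigenvalues of a matrix polynomial $B(x)$ are the roots of $\det B(x)$, counted with multiplicity. For the scalar polynomial $w(x)=\sum_{i=0}^n\sigma_ix^i$ with $\sigma_i\ge0$, $\sigma_0,\sigma_n>0$, consider for each $\kappa$ the equation $\sigma_\kappa x^\kappa=\sum_{i=0,\,i\ne\kappa}^n\sigma_ix^i$. For $\kappa=0$ it has one positive solution $t_0$; for $\kappa=n$ it has one positive solution $s_n$; for $0<\kappa<n$ it has either 0 or 2 positive solutions $s_\kappa\le t_\kappa$ (counted with multiplicity). The integers $0=h_0<h_1<\dots<h_p=n$ are $0$, $n$, and those $0<\kappa<n$ for which there are two positive solutions. Set $s_0:=0$, $t_n:=\infty$. $\mathcal A(a,b)=\{x\in\mathbb C: a\le|x|\le b\}$; its inner part is $\{x: a<|x|<b\}$.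
   Formalization: If s_{h_j}=t_{h_j}, adjacent closed annuli share a circle and exact counts can fail (m=1, B=1-2x+x^2); so the eigenvalues are shown to split into groups of m(h_i-h_{i-1}), one in each annulus, and counts are exact if s<t at h_{i-1} and h_i. *)

(* Defs.v *)
From HB Require Import structures.
From mathcomp Require Import all_boot all_order all_algebra.
From mathcomp Require Import complex polyrcf.
From mathcomp Require Import reals constructive_ereal.

Set Implicit Arguments.
Unset Strict Implicit.
Unset Printing Implicit Defensive.

Import Order.TTheory GRing.Theory Num.Theory.

Local Open Scope ring_scope.
Local Open Scope complex_scope.
Local Open Scope sesquilinear_scope.

(* A coefficient family c_0, ..., c_n is a function on nat of which only the   *)
(* values at 0, ..., n matter.                                                *)

Section MatrixPolynomials.
Variables (R : realType) (m n : nat).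
Implicit Types (A Q : nat -> 'M[R[i]]_m) (sigma : nat -> R).

Definition matpoly A : 'M[{poly R[i]}]_m :=
  \sum_(i < n.+1) 'X^i *: map_mx polyC (A i).

Definition matpolyP A : Prop :=
  [/\ \det (matpoly A) != 0, A n != 0 & A 0%N != 0].

Definition scaled_unitary A sigma Q : Prop :=
  forall i, (i <= n)%N ->
    [/\ 0 <= sigma i, (Q i)^t* *m Q i = 1%:M & A i = (sigma i)%:C *: Q i].

Definition matpolyQ A : Prop :=
  matpolyP A /\ exists sigma Q, scaled_unitary A sigma Q.

(* The roots of \det A(x), each repeated according to its multiplicity.       *)
Definition eigenvalues A : seq R[i] :=
  sval (closed_field_poly_normal (\det (matpoly A))).

Lemma eigenvaluesE A :
  \det (matpoly A) =
  lead_coef (\det (matpoly A)) *: \prod_(z <- eigenvalues A) ('X - z%:P).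
Proof. exact: (svalP (closed_field_poly_normal (\det (matpoly A)))). Qed.

Lemma mem_eigenvalues A (z : R[i]) : \det (matpoly A) != 0 ->
  (z \in eigenvalues A) = root (\det (matpoly A)) z.
Proof.
move=> nz; rewrite [in RHS]eigenvaluesE rootZ ?lead_coef_eq0//.
by rewrite root_prod_XsubC.
Qed.

End MatrixPolynomials.

Section Pellet.
Variables (R : realType) (n : nat) (sigma : nat -> R).

Definition pellet_poly (k : nat) : {poly R} :=
  sigma k *: 'X^k - \sum_(i < n.+1 | (i : nat) != k) sigma i *: 'X^i.

(* The distinct positive solutions, in increasing order.                      *)
Definition pellet_roots (k : nat) : seq R :=
  [seq x <- rootsR (pellet_poly k) | 0 < x].

Lemma mem_pellet_roots (k : nat) (x : R) : pellet_poly k != 0 ->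
  (x \in pellet_roots k) =
  (0 < x) && (sigma k * x ^+ k ==
              \sum_(i < n.+1 | (i : nat) != k) sigma i * x ^+ i).
Proof.
move=> nz; rewrite mem_filter; congr (_ && _).
rewrite -(roots_on_rootsR nz) in_itv /= /root /pellet_poly !hornerE horner_sum subr_eq0.
by congr (_ == _); apply: eq_bigr => i _; rewrite !hornerE.
Qed.

Definition pellet_count (k : nat) : nat :=
  \sum_(x <- pellet_roots k) mup x (pellet_poly k).

(* A double solution occurs once in pellet_roots, and then s_k = t_k.         *)
Definition pellet_s (k : nat) : \bar R :=
  if k == 0%N then 0%E else (head 0 (pellet_roots k))%:E.

Definition pellet_t (k : nat) : \bar R :=
  if k == n then +oo%E else (last 0 (pellet_roots k))%:E.

(* h_i is the i-th entry; pellet_count is 0 or 2 when 0 < k < n.              *)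
Definition pellet_h : seq nat :=
  [seq k <- iota 0 n.+1 | [|| k == 0, k == n | pellet_count k == 2]%N].

Definition pellet_p : nat := (size pellet_h).-1.

End Pellet.

Section Annuli.
Variable R : realType.

Definition annulus (a b : \bar R) : pred R[i] :=
  fun x => (a <= (complex.Re `|x|)%:E <= b)%E.

Definition inner_annulus (a b : \bar R) : pred R[i] :=
  fun x => (a < (complex.Re `|x|)%:E < b)%E.

End Annuli.

(* Main.v *)
Require Import Defs.
From HB Require Import structures.
From mathcomp Require Import all_boot all_order all_algebra.
From mathcomp Require Import complex polyrcf ring.
From mathcomp Require Import reals constructive_ereal.

Import Order.TTheory GRing.Theory Num.Theory.

Local Open Scope ring_scope.

(** The theorem follows from two inequalities, for every k among the h_i:
      #{eigenvalues with |z| < t_k} <= m k <= #{eigenvalues with |z| <= s_k}.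
    Since there are m n eigenvalues in all ([size_eigenvalues]), these
    inequalities ([count_pellet]) say that in the list of the eigenvalues sorted
    by modulus, the entries from position m h_(i-1) on have modulus at least
    t_(h_(i-1)), and those before position m h_i have modulus at most s_(h_i).
    The slices between consecutive positions m h_i are the required groups; the
    exact count and the absence of eigenvalues in the inner annuli follow by
    comparing the two inequalities when s_k < t_k.

    The first inequality is obtained without a homotopy or Rouche argument, from
    the linear recurrence sum_i B_i u_(j+i) = 0 on sequences of vectors.  On the
    one hand, N eigenvalues in the open disc of radius r, counted with
    multiplicity, yield N linearly independent solutions that are O(rho ^ j) for
    some rho < r ([geo_solutions]); they are built by splitting off one linear
    right factor of the matrix polynomial for each eigenvalue
    ([poly_mx_deflation]).  On the other hand, suppose that
    sum_(i != k) sigma_i r ^ i <= sigma_k r ^ k with k < n.  As the coefficients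
    are sigma_i times isometries, a solution u of that decay whose first k terms
    vanish is zero: otherwise the equation at the last index where |u_l| / r ^ l
    is maximal is violated ([dominant_recurrence_eq0]).  Hence N <= m k.  For
    k = n the bound is the total number of eigenvalues.

    The second inequality is the first one for the reversed polynomial
    x^n B(1/x), whose eigenvalues are the inverses of those of B
    ([count_eigenvalues_gt]); for k = 0 it is void. *)

Set Implicit Arguments.
Unset Strict Implicit.
Unset Printing Implicit Defensive.

Local Open Scope complex_scope.
Local Open Scope sesquilinear_scope.

(** * Splitting off a root of the determinant *)

(** The matrix determinant lemma for a rank-one update of the identity. *)
Lemma det1D_mulmx (K : comPzRingType) (m : nat) (v : 'cV[K]_m) (f : 'rV[K]_m) :
  \det (1%:M + v *m f) = 1 + (f *m v) 0 0.
Proof.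
have E1 : block_mx (1%:M + v *m f) v 0 1%:M *m block_mx 1%:M 0 (- f) 1%:M
        = block_mx 1%:M v (- f) 1%:M :> 'M[K]_(m + 1).
  by rewrite mulmx_block !mulmx1 !mul1mx !mulmx0 mulmxN !add0r ?addr0 addrK.
have E2 : block_mx 1%:M 0 (- f) 1%:M *m block_mx 1%:M v 0 (1%:M + f *m v)
        = block_mx 1%:M v (- f) 1%:M :> 'M[K]_(m + 1).
  rewrite mulmx_block !mulmx1 !mul1mx ?mulmx0 !mul0mx !addr0 mulNmx.
  by rewrite addrCA addNr addr0.
have := congr1 determinant E1; rewrite -E2 !det_mulmx !(det_ublock, det_lblock).
by rewrite !det1 !mulr1 !mul1r => ->; rewrite det_mx11 !mxE mulr1n.
Qed.

Section Deflation.
Variables (F : fieldType) (m : nat).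
Implicit Types (M : 'M[{poly F}]_m) (z : F).

(** A root z of det M splits off a linear right factor, M = G D, where G is the
    matrix under the last determinant and D = (1 - v f) + ('X - z) v f.  Here v
    spans a line in the kernel of M(z), and v f is a projection onto it. *)
Lemma poly_mx_deflation M z : root (\det M) z ->
  exists (v : 'cV[F]_m) (f : 'rV[F]_m) (q : 'cV[{poly F}]_m),
    [/\ f *m v = 1%:M,
        M *m map_mx polyC v = ('X - z%:P) *: q &
        \det M = \det (M *m map_mx polyC (1%:M - v *m f) + q *m map_mx polyC f)
                 * ('X - z%:P)].
Proof.
move=> rz.
have: \det (map_mx (horner_eval z) M)^T == 0.
  by rewrite det_tr det_map_mx; exact: rz.
case/det0P => w nz wM.
have [i wi] : exists i, w 0 i != 0.
  apply/existsP; apply: contraNT nz; rewrite negb_exists => /forallP w0.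
  by apply/eqP/rowP => i; rewrite mxE; apply/eqP; rewrite -[_ == _]negbK w0.
(* f is a coordinate form, normalised so that f v = 1 *)
pose v := w^T; pose f : 'rV[F]_m := (w 0 i)^-1 *: delta_mx 0 i.
have fv : f *m v = 1%:M.
  rewrite -scalemxAl -rowE; apply/matrixP => a b.
  by rewrite !ord1 !mxE mulVf.
have Mv : map_mx (horner_eval z) (M *m map_mx polyC v) = 0.
  rewrite map_mxM /= -map_mx_comp.
  have -> : map_mx (horner_eval z \o polyC) v = v.
    by apply/matrixP => a b; rewrite mxE /= /horner_eval hornerC.
  apply: trmx_inj; rewrite trmx_mul trmx0 [v^T]trmxK; exact: wM.
pose q := map_mx (fun p => p %/ ('X - z%:P)) (M *m map_mx polyC v).
have Mq : M *m map_mx polyC v = ('X - z%:P) *: q.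
  apply/matrixP => a b; rewrite [in RHS]mxE [X in _ * X]mxE mulrC divpK //.
  rewrite dvdp_XsubCl; apply/eqP; have /matrixP/(_ a b) := Mv.
  by rewrite [LHS]mxE [in RHS]mxE.
exists v, f, q; split => //.
set G := _ + _ *m _.
(* the right factor, written as a rank-one update of the identity *)
pose D : 'M[{poly F}]_m :=
  1%:M + map_mx polyC v *m (('X - z%:P - 1) *: map_mx polyC f).
have fvP : map_mx polyC f *m map_mx polyC v = 1%:M.
  by rewrite -map_mxM fv map_scalar_mx.
have dD : \det D = 'X - z%:P.
  by rewrite det1D_mulmx -scalemxAl fvP mxE mxE mulr1 addrCA subrr addr0.
rewrite -dD -det_mulmx; congr (\det _).
have vfD : map_mx polyC f *m D = ('X - z%:P) *: map_mx polyC f.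
  rewrite mulmxDr mulmx1 mulmxA fvP mul1mx scalerBl scale1r.
  by rewrite addrCA subrr addr0.
have vD : map_mx polyC (1%:M - v *m f) *m D = map_mx polyC (1%:M - v *m f).
  rewrite mulmxDr mulmx1 mulmxA.
  suff -> : map_mx polyC (1%:M - v *m f) *m map_mx polyC v = 0.
    by rewrite mul0mx addr0.
  by rewrite -map_mxM mulmxBl mul1mx -mulmxA fv mulmx1 subrr map_mx0.
have qf : q *m (('X - z%:P) *: map_mx polyC f)
        = M *m (map_mx polyC v *m map_mx polyC f).
  by rewrite mulmxA Mq -scalemxAr -scalemxAl.
rewrite mulmxDl -!mulmxA vfD vD qf -mulmxDr.
rewrite -map_mxM -map_mxD subrK.
by rewrite map_scalar_mx mulmx1.
Qed.

End Deflation.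

(** * Sequences of geometric growth *)

Section Geometric.
Variable F : numFieldType.
Implicit Types (rho z c : F) (a b y : nat -> F).

(** The sequence a is O(rho ^ j). *)
Definition geo_bounded rho a :=
  exists2 K, 0 <= K & forall j, `|a j| <= K * rho ^+ j.

Lemma eq_geo_bounded rho a b : a =1 b -> geo_bounded rho a -> geo_bounded rho b.
Proof. by move=> eq_ab [K K0 aK]; exists K => // j; rewrite -eq_ab. Qed.

Lemma geo_bounded0 rho : geo_bounded rho (fun=> 0).
Proof. by exists 0 => // j; rewrite normr0 mul0r. Qed.

Lemma geo_boundedD rho a b : geo_bounded rho a -> geo_bounded rho b ->
  geo_bounded rho (fun j => a j + b j).
Proof.
move=> [K K0 aK] [L L0 bL]; exists (K + L); first exact: addr_ge0.
by move=> j; rewrite mulrDl (le_trans (ler_normD _ _)) ?lerD.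
Qed.

Lemma geo_boundedM rho c a : geo_bounded rho a ->
  geo_bounded rho (fun j => c * a j).
Proof.
move=> [K K0 aK]; exists (`|c| * K); first exact: mulr_ge0.
by move=> j; rewrite normrM -mulrA ler_wpM2l.
Qed.

Lemma geo_bounded_sum rho (I : Type) (s : seq I) (P : pred I)
    (a : I -> nat -> F) :
  (forall i, geo_bounded rho (a i)) ->
  geo_bounded rho (fun j => \sum_(i <- s | P i) a i j).
Proof.
move=> ga; elim: s => [|i s IHs].
  by apply: eq_geo_bounded (geo_bounded0 rho) => j; rewrite big_nil.
case Pi: (P i).
  by apply: eq_geo_bounded (geo_boundedD (ga i) IHs) => j; rewrite big_cons Pi.
by apply: eq_geo_bounded IHs => j; rewrite big_cons Pi.
Qed.

Lemma geo_boundedX rho z : `|z| <= rho -> geo_bounded rho (fun j => z ^+ j).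
Proof.
move=> zr; exists 1 => // j; rewrite mul1r normrX.
by rewrite lerXn2r ?nnegrE // (le_trans _ zr).
Qed.

(** A first order linear recurrence with multiplier of modulus less than rho
    preserves the bound O(rho ^ j). *)
Lemma geo_bounded_rec rho z b y : `|z| < rho -> geo_bounded rho b ->
  y 0%N = 0 -> (forall j, y j.+1 = z * y j + b j) -> geo_bounded rho y.
Proof.
move=> zr [K K0 bK] y0 yS.
have r0 : 0 < rho - `|z| by rewrite subr_gt0.
have rho0 : 0 <= rho by rewrite (le_trans _ (ltW zr)).
(* the least L for which |z| L + K <= L rho *)
exists (K / (rho - `|z|)); first by rewrite divr_ge0 // ltW.
elim=> [|j IHj]; first by rewrite y0 normr0 mulr1 divr_ge0 // ltW.
rewrite yS (le_trans (ler_normD _ _)) // normrM exprS.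
have -> : K / (rho - `|z|) * (rho * rho ^+ j)
    = `|z| * (K / (rho - `|z|) * rho ^+ j) + K * rho ^+ j.
  by field; rewrite gt_eqF.
by rewrite lerD // ler_wpM2l.
Qed.

End Geometric.

(** * Decaying solutions of linear recurrences *)

Section ShiftAction.
Variable F : fieldType.

(** The action of a polynomial matrix on sequences of matrices, 'X acting as the
    shift: M = sum_i M_i 'X^i sends U to j |-> sum_i M_i U_(j+i).  The sum stops
    at i = n, which loses nothing when the entries of M have degree at most n. *)
Definition shift_act (n m p N : nat) (M : 'M[{poly F}]_(m, p))
    (U : nat -> 'M[F]_(p, N)) (j : nat) : 'M[F]_(m, N) :=
  \sum_(i < n.+1) map_mx (coefp i) M *m U (j + i)%N.

Variables (n m p : nat).

Lemma eq_shift_act N (M : 'M[{poly F}]_(m, p)) (U V : nat -> 'M_(p, N)) :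
  U =1 V -> shift_act n M U =1 shift_act n M V.
Proof. by move=> UV j; apply: eq_bigr => i _; rewrite UV. Qed.

Lemma shift_actDl N (M M' : 'M[{poly F}]_(m, p)) (U : nat -> 'M_(p, N)) j :
  shift_act n (M + M') U j = shift_act n M U j + shift_act n M' U j.
Proof.
by rewrite -big_split; apply: eq_bigr => i _; rewrite map_mxD mulmxDl.
Qed.

Lemma shift_act_mulC N q (M : 'M[{poly F}]_(m, p)) (K : 'M[F]_(p, q))
    (U : nat -> 'M_(q, N)) j :
  shift_act n (M *m map_mx polyC K) U j = shift_act n M (fun l => K *m U l) j.
Proof.
apply: eq_bigr => i _; rewrite mulmxA; congr (_ *m _).
apply/matrixP => a b; rewrite !mxE /= coef_sum.
by apply: eq_bigr => c _; rewrite !mxE coefMC.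
Qed.

Lemma shift_act_XsubC N z (M : 'M[{poly F}]_(m, p)) (U : nat -> 'M_(p, N)) j :
  (forall a b, (size (M a b) <= n)%N) ->
  shift_act n (('X - z%:P) *: M) U j
    = shift_act n M (fun l => U l.+1 - z *: U l) j.
Proof.
move=> sM; rewrite scalerBl shift_actDl; transitivity
  (shift_act n M (fun l => U l.+1) j - z *: shift_act n M U j); last first.
  rewrite scaler_sumr -sumrB; apply: eq_bigr => i _.
  by rewrite mulmxBr -scalemxAr.
congr (_ + _).
  rewrite /shift_act big_ord_recl [RHS]big_ord_recr /=.
  have -> : map_mx (coefp 0) ('X *: M) = 0.
    by apply/matrixP => a b; rewrite !mxE /= coefXM.
  have -> : map_mx (coefp n) M = 0.
    by apply/matrixP => a b; rewrite !mxE /= nth_default.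
  rewrite !mul0mx add0r addr0; apply: eq_bigr => i _; rewrite addnS.
  by congr (_ *m _); apply/matrixP => a b; rewrite !mxE /= coefXM.
rewrite scaler_sumr -sumrN; apply: eq_bigr => i _.
rewrite scalemxAl -mulNmx; congr (_ *m _).
by apply/matrixP => a b; rewrite !mxE /= coefN coefCM.
Qed.

Lemma shift_act_row N1 N2 (M : 'M[{poly F}]_(m, p)) (U : nat -> 'M_(p, N1))
    (V : nat -> 'M_(p, N2)) j :
  shift_act n M (fun l => row_mx (U l) (V l)) j
    = row_mx (shift_act n M U j) (shift_act n M V j).
Proof.
rewrite /shift_act (eq_bigr _ (fun i _ => mul_mx_row _ _ _)).
elim/big_rec3: _ => [|i x y w _ ->]; first by rewrite row_mx0.
by rewrite add_row_mx.
Qed.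

Lemma shift_act0 N (M : 'M[{poly F}]_(m, p)) j :
  shift_act n M (fun=> 0 : 'M_(p, N)) j = 0.
Proof. by apply: big1 => i _; rewrite mulmx0. Qed.

End ShiftAction.

Section Solutions.
Variables (F : numFieldType) (m n : nat) (rho : F).

(** The solution of y_(j+1) = z y_j + b_j with y_0 = 0. *)
Fixpoint lin_rec N z (b : nat -> 'rV[F]_N) j : 'rV[F]_N :=
  if j is j'.+1 then z *: lin_rec z b j' + b j' else 0.

(** If the monic polynomial with roots zs (repetitions allowed) divides det M and
    all of zs lies in the disc |z| < rho, then the recurrence with symbol M has
    at least size zs linearly independent solutions that are O(rho ^ j).  They
    are the columns of U. *)
Lemma geo_solutions (zs : seq F) (M : 'M[{poly F}]_m) :
  (forall a b, (size (M a b) <= n.+1)%N) ->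
  \prod_(z <- zs) ('X - z%:P) %| \det M ->
  {in zs, forall z, `|z| < rho} ->
  exists U : nat -> 'M[F]_(m, size zs),
    [/\ forall j, shift_act n M U j = 0,
        forall c : 'cV_(size zs), (forall j, U j *m c = 0) -> c = 0 &
        forall a b, geo_bounded rho (fun j => U j a b)].
Proof.
elim: zs M => [|z zs IHzs] M sM dM zr.
  exists (fun=> 0); split=> [j|c _|a []//].
    exact: shift_act0.
  exact: flatmx0.
have rz : root (\det M) z.
  by rewrite -dvdp_XsubCl (dvdp_trans _ dM) // big_cons dvdp_mulIl.
have [v [f [q [fv Mv dG]]]] := poly_mx_deflation rz.
set G := (_ + _) in dG.
have sq a b : (size (q a b) <= n)%N.
  have [->|q0] := eqVneq (q a b) 0; first by rewrite size_poly0.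
  have : (size (('X - z%:P) * q a b)%R <= n.+1)%N.
    have /matrixP/(_ a b) := Mv; rewrite !mxE => <-.
    apply: (leq_trans (size_sum _ _ _)); apply/bigmax_leqP => c _.
    rewrite mxE mulrC mul_polyC; exact: leq_trans (size_scale_leq _ _) (sM _ _).
  by rewrite mulrC size_Mmonic ?monicXsubC // size_XsubC addn2.
have sG a b : (size (G a b) <= n.+1)%N.
  rewrite mxE (leq_trans (size_polyD _ _)) // geq_max; apply/andP; split.
    rewrite mxE; apply: (leq_trans (size_sum _ _ _)); apply/bigmax_leqP => c _.
    rewrite mxE mulrC mul_polyC; exact: leq_trans (size_scale_leq _ _) (sM _ _).
  rewrite mxE; apply: (leq_trans (size_sum _ _ _)); apply/bigmax_leqP => c _.
  rewrite mxE mulrC mul_polyC; apply: leq_trans (size_scale_leq _ _) _.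
  exact: leqW (sq _ _).
have dvG : \prod_(z <- zs) ('X - z%:P) %| \det G.
  move: dM; rewrite big_cons dG mulrC dvdp_mul2r //.
  by rewrite polyXsubC_eq0.
have [] := IHzs G sG dvG; first by move=> x xs; apply: zr; rewrite inE xs orbT.
move=> V [GV Vfree Vgeo].
(* Solving D U = V, where D is the right factor split off: the component of U
   along v obeys a first order recurrence, and the sequence z ^ j v is the new
   solution, in the kernel of D. *)
pose E := 1%:M - v *m f.
pose Y := lin_rec z (fun j => f *m V j).
pose W j : 'M_(m, 1 + size zs) := row_mx (z ^+ j *: v) (E *m V j + v *m Y j).
have Ev : E *m v = 0 by rewrite mulmxBl mul1mx -mulmxA fv mulmx1 subrr.
have fE : f *m E = 0 by rewrite mulmxBr mulmx1 mulmxA fv mul1mx subrr.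
have EE : E *m E = E by rewrite {2}/E mulmxBr mulmx1 mulmxA Ev mul0mx subr0.
have EW j : E *m W j = row_mx 0 (E *m V j).
  rewrite mul_mx_row -scalemxAr Ev scaler0 mulmxDr !mulmxA Ev EE mul0mx.
  by rewrite addr0.
have fW j : f *m W j = row_mx (z ^+ j)%:M (Y j).
  rewrite mul_mx_row -scalemxAr fv scale_scalar_mx mulr1 mulmxDr !mulmxA fE fv.
  by rewrite mul0mx mul1mx add0r.
have fWS j : f *m W j.+1 - z *: (f *m W j) = row_mx 0 (f *m V j).
  rewrite !fW scale_row_mx opp_row_mx add_row_mx scale_scalar_mx exprS subrr.
  by rewrite /= addrAC subrr add0r.
have Mdec : M = M *m map_mx polyC E + (('X - z%:P) *: q) *m map_mx polyC f.
  by rewrite -Mv -mulmxA -mulmxDr -map_mxM -map_mxD subrK map_scalar_mx mulmx1.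
exists W; split.
- move=> j; rewrite Mdec shift_actDl !shift_act_mulC shift_act_XsubC //.
  rewrite (eq_shift_act _ _ EW) (eq_shift_act _ _ fWS).
  rewrite !shift_act_row; apply: (etrans (@add_row_mx _ _ 1 (size zs) _ _ _ _)).
  rewrite !shift_act0 addr0 -!shift_act_mulC -shift_actDl GV; exact: row_mx0.
- move=> c Wc; rewrite -[c](@vsubmxK _ 1 (size zs) 1).
  set c0 := usubmx _; set c1 := dsubmx _.
  have EVc j : E *m V j *m c1 = 0.
    have : E *m W j *m c = 0 by rewrite -mulmxA Wc mulmx0.
    by rewrite EW -[c](@vsubmxK _ 1 (size zs) 1) mul_row_col mul0mx add0r.
  have fVc j : f *m V j *m c1 = 0.
    have : (f *m W j.+1 - z *: (f *m W j)) *m c = 0.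
      by rewrite mulmxBl -scalemxAl -!mulmxA !Wc !mulmx0 scaler0 subrr.
    by rewrite fWS -[c](@vsubmxK _ 1 (size zs) 1) mul_row_col mul0mx add0r.
  have c1_0 : c1 = 0.
    apply: Vfree => j; have -> : V j = E *m V j + v *m (f *m V j).
      by rewrite mulmxA -mulmxDl subrK mul1mx.
    by rewrite mulmxDl EVc -mulmxA fVc mulmx0 addr0.
  have : f *m W 0%N *m c = 0 by rewrite -mulmxA Wc mulmx0.
  rewrite fW -[c](@vsubmxK _ 1 (size zs) 1) mul_row_col -/c1 c1_0 mulmx0 addr0.
  by rewrite mul1mx -/c0 => ->; rewrite col_mx0.
have zrho : `|z| < rho by apply: zr; rewrite mem_head.
have geoE (k : nat) (K : 'M[F]_(k, m)) a b :
    geo_bounded rho (fun j => (K *m V j) a b).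
  apply: (@eq_geo_bounded _ _ (fun j => \sum_c K a c * V j c b)).
    by move=> j; rewrite mxE.
  by apply: geo_bounded_sum => c; apply: geo_boundedM.
move=> a b; rewrite /W; case: (@splitP 1 (size zs) b) => b' eb.
  have -> : b = lshift (size zs) b' by apply: val_inj.
  apply: (@eq_geo_bounded _ _ (fun j => v a b' * z ^+ j)).
    by move=> j; rewrite mulrC; apply: esym (etrans (row_mxEl _ _ _ _) _); rewrite mxE.
  by apply: geo_boundedM; apply: geo_boundedX; exact: ltW.
have -> : b = rshift 1 b' by apply: val_inj.
apply: (@eq_geo_bounded _ _ (fun j => (E *m V j) a b' + v a 0 * Y j 0 b')).
  move=> j; apply: esym (etrans (row_mxEr _ _ _ _) _).
  by rewrite [LHS]mxE [X in _ + X]mxE big_ord1.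
apply: geo_boundedD; first exact: geoE.
apply: geo_boundedM.
apply: (geo_bounded_rec zrho (geoE _ f 0 b')) => [|j]; first by rewrite mxE.
by rewrite /Y /= [in LHS]mxE [X in X + _]mxE.
Qed.

End Solutions.

(** * The Euclidean norm *)

Section EuclideanNorm.
Variables (R : realType) (m : nat).
Implicit Types (u v : 'cV[R[i]]_m).

(** The Euclidean norm of a complex column vector, as an element of R. *)
Definition l2norm u : R := complex.Re (sqrtC (dotmx u^T u^T)).

Lemma l2normC u : (l2norm u)%:C = sqrtC (dotmx u^T u^T).
Proof. by rewrite /l2norm RRe_real // ger0_real // sqrtC_ge0 dnorm_ge0. Qed.

Lemma l2norm_ge0 u : 0 <= l2norm u.
Proof. by rewrite -lecR l2normC sqrtC_ge0 dnorm_ge0. Qed.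

Lemma l2norm_eq0 u : (l2norm u == 0) = (u == 0).
Proof.
rewrite -(inj_eq (@complexI R)) l2normC sqrtC_eq0 dnorm_eq0.
by rewrite -(inj_eq (@trmx_inj _ _ _)) trmx0.
Qed.

Lemma l2norm0 : l2norm 0 = 0.
Proof. by apply/eqP; rewrite l2norm_eq0. Qed.

Lemma l2normD u v : l2norm (u + v) <= l2norm u + l2norm v.
Proof.
rewrite -lecR rmorphD /= !l2normC linearD /=.
by case: (triangle_lerif (@dotmx _ m) u^T v^T).
Qed.

Lemma l2normZ (c : R[i]) u : (l2norm (c *: u))%:C = `|c| * (l2norm u)%:C.
Proof.
rewrite !l2normC linearZ /= dnormZ sqrtCM ?qualifE /= ?exprn_ge0 ?dnorm_ge0 //.
by rewrite sqrCK.
Qed.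

Lemma l2normZr (c : R) u : 0 <= c -> l2norm (c%:C *: u) = c * l2norm u.
Proof.
move=> c0; apply: (@complexI R); rewrite l2normZ rmorphM /= ger0_norm //.
by rewrite lecR.
Qed.

Lemma l2normN u : l2norm (- u) = l2norm u.
Proof.
by apply: (@complexI R); rewrite -scaleN1r l2normZ normrN1 mul1r.
Qed.

Lemma l2norm_sum (I : Type) (s : seq I) (P : pred I) (f : I -> 'cV_m) :
  l2norm (\sum_(i <- s | P i) f i) <= \sum_(i <- s | P i) l2norm (f i).
Proof.
elim/big_rec2: _ => [|i x u _ IH]; first by rewrite l2norm0.
by rewrite (le_trans (l2normD _ _)) // lerD2l.
Qed.

Lemma dotmx_trmx u : dotmx u^T u^T = (u^t* *m u) 0 0.
Proof.
by rewrite dotmxE !mxE; apply: eq_bigr => i _; rewrite !mxE mulrC.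
Qed.

Lemma l2norm_unitary (S : 'M[R[i]]_m) u :
  S^t* *m S = 1%:M -> l2norm (S *m u) = l2norm u.
Proof.
move=> S1; rewrite /l2norm !dotmx_trmx trmx_mul map_mxM.
by rewrite -mulmxA [_ *m (S *m u)]mulmxA S1 mul1mx.
Qed.

Lemma l2norm_le_sum u : (l2norm u)%:C <= \sum_a `|u a 0|.
Proof.
have le_sq : l2norm u ^+ 2 <= (\sum_a complex.Re `|u a 0|) ^+ 2.
  rewrite -lecR !rmorphXn /= l2normC sqrtCK dotmxE mxE rmorph_sum /=.
  rewrite (eq_bigr (fun a => `|u a 0| ^+ 2)); last first.
    by move=> a _; rewrite !mxE normCK.
  rewrite [in leRHS](eq_bigr (fun a => `|u a 0|)); last by [].
  rewrite [leRHS]expr2 mulr_suml ler_sum // => a _; rewrite expr2 ler_wpM2l //.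
  by rewrite (bigD1 a) //= lerDl sumr_ge0.
have Re_ge0 (z : R[i]) : 0 <= complex.Re `|z|.
  by have: 0 <= `|z| := normr_ge0 z; rewrite lecE => /andP[].
rewrite ler_pXn2r ?nnegrE ?l2norm_ge0 ?sumr_ge0 // -lecR in le_sq.
by apply: (le_trans le_sq); rewrite rmorph_sum.
Qed.

End EuclideanNorm.

(** * Recurrences with a dominant coefficient *)

Lemma geo_eventually_lt (R : archiRealFieldType) (K q e : R) :
  0 <= K -> 0 <= q < 1 -> 0 < e ->
  exists J, forall l, (J <= l)%N -> K * q ^+ l < e.
Proof.
move=> K0 /andP[q0 q1] e0; have [q_eq0|q_neq0] := eqVneq q 0.
  by exists 1%N => -[//|l] _; rewrite q_eq0 expr0n mulr0.
have qgt0 : 0 < q by rewrite lt_def q_neq0.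
pose x := q^-1 - 1.
have x0 : 0 < x by rewrite subr_gt0 invf_gt1.
have bern l : 1 + l%:R * x <= (1 + x) ^+ l.
  elim: l => [|l IHl]; first by rewrite mul0r addr0.
  rewrite exprSr; apply: le_trans (ler_wpM2r _ IHl); last first.
    by rewrite addr_ge0 // ltW.
  have -> : (1 + l%:R * x) * (1 + x) = 1 + l.+1%:R * x + l%:R * x ^+ 2.
    by rewrite -natr1; ring.
  by rewrite lerDl mulr_ge0 ?sqr_ge0.
exists (Num.bound (K / (e * x))) => l Jl.
have Kex : K / (e * x) < l%:R.
  apply: lt_le_trans (archi_boundP _) _; last by rewrite ler_nat.
  by rewrite divr_ge0 // mulr_ge0 ?ltW.
rewrite -ltr_pdivlMr ?exprn_gt0 // -exprVn (_ : q^-1 = 1 + x); last first.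
  by rewrite /x addrCA subrr addr0.
rewrite -ltr_pdivrMl // (lt_le_trans _ (bern l)) //.
move: Kex; rewrite ltr_pdivrMr ?mulr_gt0 // => Kex.
rewrite ltr_pdivrMl // mulrDr mulr1 (lt_trans Kex) //.
by rewrite mulrCA ltrDr.
Qed.

(** If the values of a are eventually below some value of a, then a attains its
    maximum, and there is a last index where it does. *)
Lemma last_maximum (R : realDomainType) (a : nat -> R) (l0 J : nat) :
  (forall l, (J <= l)%N -> a l < a l0) ->
  exists l, [/\ a l0 <= a l, forall j, a j <= a l &
                forall j, (l < j)%N -> a j < a l].
Proof.
move=> aJ; have l0J : (l0 < J)%N.
  by rewrite ltnNge; apply/negP => /aJ; rewrite ltxx.
case: (@arg_maxP _ _ _ (Ordinal l0J) predT (fun i : 'I_J => a i)) => // i1 _ max1.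
have le_max j : a j <= a i1.
  have [jJ|jJ] := ltnP j J; first exact: (max1 (Ordinal jJ)).
  by rewrite (le_trans (ltW (aJ _ jJ))) //; exact: (max1 (Ordinal l0J)).
have exP : exists l, (l < J)%N && (a l == a i1).
  by exists i1; rewrite ltn_ord eqxx.
have ubP l : (l < J)%N && (a l == a i1) -> (l <= J)%N by case/andP=> /ltnW.
case: (ex_maxnP exP ubP) => l /andP[lJ /eqP al] maxl.
exists l; rewrite al; split=> // j lj.
rewrite lt_neqAle le_max andbT; apply/negP => /eqP aj.
have jJ : (j < J)%N.
  rewrite ltnNge; apply/negP => /aJ; rewrite aj => /lt_geF/negP; apply.
  exact: (max1 (Ordinal l0J)).
by have := maxl j; rewrite jJ aj eqxx => /(_ isT); rewrite leqNgt lj.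
Qed.

(** If the k-th weight dominates on the circle of radius r, even weakly, then a
    solution of the recurrence that decays faster than r ^ j is determined by its
    first k terms. *)
Lemma dominant_recurrence_eq0 (R : realType) (m n k : nat) (B S : nat -> 'M[R[i]]_m)
    (sigma : nat -> R) (r rho K : R) (u : nat -> 'cV[R[i]]_m) :
  scaled_unitary n B sigma S -> (k < n)%N -> 0 < sigma n ->
  \sum_(i < n.+1 | (i : nat) != k) sigma i * r ^+ i <= sigma k * r ^+ k ->
  0 <= rho < r -> 0 <= K ->
  (forall j, l2norm (u j) <= K * rho ^+ j) ->
  (forall j, \sum_(i < n.+1) B i *m u (j + i)%N = 0) ->
  (forall j, (j < k)%N -> u j = 0) ->
  forall j, u j = 0.
Proof.
move=> dec kn sn dom /andP[rho0 rho_r] K0 uK rec u0 l0.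
have r0 : 0 < r by exact: le_lt_trans rho_r.
apply/eqP; apply: contraT => ul0.
pose a l := l2norm (u l) / r ^+ l.
have ua l : l2norm (u l) = a l * r ^+ l by rewrite divfK // expf_neq0 // gt_eqF.
have al0 : 0 < a l0.
  by rewrite divr_gt0 ?exprn_gt0 // lt_def l2norm_eq0 ul0 l2norm_ge0.
have q01 : 0 <= rho / r < 1.
  by rewrite divr_ge0 ?(ltW r0) //= ltr_pdivrMr // mul1r.
have [J JP] := geo_eventually_lt K0 q01 al0.
have aJ l : (J <= l)%N -> a l < a l0.
  move=> /JP; apply: le_lt_trans.
  by rewrite expr_div_n mulrA ler_pM2r // invr_gt0 exprn_gt0.
have [l [al le_a lt_a]] := last_maximum aJ.
have al_gt0 : 0 < a l by exact: lt_le_trans al.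
have kl : (k <= l)%N.
  rewrite leqNgt; apply/negP => /u0 ul; move: al_gt0.
  by rewrite /a ul l2norm0 mul0r ltxx.
(* In the equation whose k-th term involves u_l, the k-th term has weighted norm
   sigma_k r ^ k (a l), while the others sum to strictly less: the term of index
   n involves a later a (j + n), which is below the maximum a l. *)
pose j := (l - k)%N; have jk : (j + k)%N = l by rewrite subnK.
have kn1 : (k < n.+1)%N by exact: leqW.
have normB i : (i < n.+1)%N ->
    l2norm (B i *m u (j + i)%N) = sigma i * r ^+ i * a (j + i)%N * r ^+ j.
  rewrite ltnS => /dec[s0 Si ->]; rewrite -scalemxAl l2normZr //.
  by rewrite l2norm_unitary // ua exprD; ring.
have : l2norm (B k *m u (j + k)%N)
    <= \sum_(i < n.+1 | (i : nat) != k) l2norm (B i *m u (j + i)%N).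
  have := rec j; rewrite (bigD1 (Ordinal kn1)) //= => /eqP.
  by rewrite addr_eq0 => /eqP ->; rewrite l2normN; apply: l2norm_sum.
rewrite normB // jk leNgt => /negP[].
rewrite (eq_bigr _ (fun i _ => normB _ (ltn_ord i))) -mulr_suml.
rewrite ltr_pM2r ?exprn_gt0 //.
apply: (@lt_le_trans _ _
  ((\sum_(i < n.+1 | (i : nat) != k) sigma i * r ^+ i) * a l)); last first.
  by rewrite ler_wpM2r // ltW.
rewrite mulr_suml (bigD1 ord_max) /=; last by rewrite gtn_eqF.
rewrite [ltRHS](bigD1 ord_max) /=; last by rewrite gtn_eqF.
rewrite ltr_leD //.
  by rewrite ltr_pM2l ?mulr_gt0 ?exprn_gt0 // lt_a // -jk ltn_add2l.
apply: ler_sum => i _; rewrite ler_wpM2l // mulr_ge0 ?exprn_ge0 ?(ltW r0) //.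
by have := ltn_ord i; rewrite ltnS => /dec[].
Qed.

Lemma geo_radius (R : realType) (r : R) (zs : seq R[i]) : 0 < r ->
  {in zs, forall z, `|z| < r%:C} ->
  exists2 rho : R, 0 <= rho < r & {in zs, forall z, `|z| < rho%:C}.
Proof.
move=> r0; elim: zs => [_|z zs IHzs zr]; first by exists 0; rewrite ?lexx.
have [|rho /andP[rho0 rhor] rhoP] := IHzs.
  by move=> x xs; apply: zr; rewrite inE xs orbT.
pose t := complex.Re `|z|.
have zt : `|z| = t%:C by rewrite RRe_real // normr_real.
have tr : t < r by rewrite -ltcR -zt zr // mem_head.
exists (Num.max rho ((t + r) / 2)).
  rewrite le_max rho0 /= gt_max rhor midf_lt //.
move=> x; rewrite inE => /orP[/eqP->|xs].
  by rewrite zt ltcR lt_max midf_lt // orbT.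
by rewrite (lt_le_trans (rhoP _ xs)) // lecR le_max lexx.
Qed.

Lemma matpoly_size (R : realType) (m n : nat) (B : nat -> 'M[R[i]]_m) a b :
  (size (matpoly n B a b) <= n.+1)%N.
Proof.
rewrite /matpoly summxE; apply: (leq_trans (size_sum _ _ _)).
apply/bigmax_leqP => i _; rewrite !mxE mulrC mul_polyC.
by rewrite (leq_trans (size_scale_leq _ _)) // size_polyXn.
Qed.

Lemma matpoly_coef (R : realType) (m n : nat) (B : nat -> 'M[R[i]]_m) i :
  (i <= n)%N -> map_mx (coefp i) (matpoly n B) = B i.
Proof.
move=> le_in; apply/matrixP => a b; rewrite mxE /matpoly summxE /= coef_sum.
rewrite (bigD1 (Ordinal (le_in : (i < n.+1)%N))) //= big1 => [|j ji].
  by rewrite !mxE mulrC coefCM coefXn eqxx mulr1 addr0.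
rewrite !mxE mulrC coefCM coefXn (_ : _ == _ = false) ?mulr0 //.
by apply/negbTE; apply: contra ji => /eqP ij; apply/eqP/val_inj.
Qed.

(** Under weak dominance of the k-th weight on the circle of radius r, at most
    m k eigenvalues lie in the open disc: more would give more than m k
    independent decaying solutions, hence a nonzero one whose first k terms, that
    is m k scalars, vanish. *)
Lemma interior_eigenvalues_le (R : realType) (m n k : nat) (B S : nat -> 'M[R[i]]_m)
    (sigma : nat -> R) (r : R) (zs : seq R[i]) :
  scaled_unitary n B sigma S -> (k < n)%N -> 0 < sigma n -> 0 < r ->
  \sum_(i < n.+1 | (i : nat) != k) sigma i * r ^+ i <= sigma k * r ^+ k ->
  {in zs, forall z, `|z| < r%:C} ->
  \prod_(z <- zs) ('X - z%:P) %| \det (matpoly n B) ->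
  (size zs <= m * k)%N.
Proof.
move=> dec kn sn r0 dom zr dv.
have [rho /andP[rho0 rhor] zrho] := geo_radius r0 zr.
have [U [recU freeU geoU]] := geo_solutions (matpoly_size n B) dv zrho.
rewrite leqNgt; apply/negP => big_zs.
pose T : 'M_(size zs, m * k) :=
  \matrix_b mxvec (\matrix_(a < m, j < k) U j a b).
have : kermx T != 0.
  rewrite kermx_eq0 /row_free; apply/eqP => rT.
  by have := rank_leq_col T; rewrite rT leqNgt big_zs.
case/rowV0Pn => w /sub_kermxP wT /eqP nzw; apply: nzw.
apply: (can_inj (@trmxK _ _ _)); rewrite trmx0; apply: freeU.
have geou a : geo_bounded rho%:C (fun j => (U j *m w^T) a 0).
  apply: (@eq_geo_bounded _ _ (fun j => \sum_b w^T b 0 * U j a b)).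
    by move=> j; rewrite mxE; apply: eq_bigr => b _; rewrite mulrC.
  by apply: geo_bounded_sum => b; apply: geo_boundedM.
have [L L0 LP] : geo_bounded rho%:C (fun j => \sum_a `|(U j *m w^T) a 0|).
  apply: geo_bounded_sum => a; case: (geou a) => K K0 aK.
  by exists K => // j; rewrite normr_id.
have Lr : L = (complex.Re L)%:C by rewrite RRe_real // ger0_real.
apply: (dominant_recurrence_eq0 dec kn sn dom (rho := rho) (K := complex.Re L)).
- by rewrite rho0 rhor.
- by rewrite -lecR -Lr.
- move=> j; rewrite -lecR rmorphM rmorphXn /= -Lr.
  apply: le_trans (l2norm_le_sum _) (le_trans _ (LP j)).
  by rewrite ger0_norm // sumr_ge0.
- move=> j; rewrite -[RHS](mul0mx _ w^T) -(recU j) mulmx_suml.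
  apply: eq_bigr => i _; rewrite matpoly_coef ?mulmxA //.
  by rewrite -ltnS ltn_ord.
move=> j jk; apply/colP => a; rewrite [RHS]mxE.
have /rowP/(_ (mxvec_index a (Ordinal jk))) := wT; rewrite !mxE => {2}<-.
by apply: eq_bigr => b _; rewrite !mxE mxvecE mxE mulrC.
Qed.

(** * Reversal and the eigenvalues outside a disc *)

(** Polynomials that agree at every nonzero point are equal. *)
Lemma poly_eq_off0 (F : numDomainType) (p q : {poly F}) :
  (forall x, x != 0 -> p.[x] = q.[x]) -> p = q.
Proof.
move=> pq; apply/eqP; rewrite -subr_eq0; apply: contraT => nz.
have := @max_poly_roots _ _ [seq k.+1%:R | k <- iota 0 (size (p - q))] nz.
rewrite size_map size_iota ltnn; apply.
  apply/allP => _ /mapP[k _ ->]; rewrite rootE hornerD hornerN pq ?subrr //.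
  by rewrite pnatr_eq0.
by rewrite map_inj_uniq ?iota_uniq // => i j /eqP; rewrite eqr_nat => /eqP[].
Qed.

Section Reversal.
Variables (R : realType) (m n : nat).
Implicit Types (B S : nat -> 'M[R[i]]_m) (sigma : nat -> R).

(** The coefficients of the reversed polynomial x^n B(1/x). *)
Definition revcoef T (c : nat -> T) (i : nat) : T := c (n - i)%N.

Lemma det_matpoly_horner B x :
  (\det (matpoly n B)).[x] = \det (\sum_(i < n.+1) x ^+ i *: B i).
Proof.
rewrite -[LHS]/(horner_eval x _) -det_map_mx; congr (\det _).
apply/matrixP => a b; rewrite mxE /matpoly !summxE /= /horner_eval horner_sum.
by apply: eq_bigr => i _; rewrite !mxE hornerM hornerXn hornerC.
Qed.

Lemma det_matpoly_rev_horner B x : x != 0 ->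
  (\det (matpoly n (revcoef B))).[x]
    = x ^+ (m * n) * (\det (matpoly n B)).[x^-1].
Proof.
move=> x0; rewrite !det_matpoly_horner mulnC exprM -detZ; congr (\det _).
rewrite scaler_sumr (reindex_inj rev_ord_inj) /=; apply: eq_bigr => i _.
have le_in : (i <= n)%N by rewrite -ltnS.
rewrite scalerA /revcoef subSS subKn // exprVn; congr (_ *: _).
have -> : x ^+ n = x ^+ (n - i) * x ^+ i by rewrite -exprD subnK.
by rewrite mulfK // expf_neq0.
Qed.

Section Spectrum.
Variables (B : nat -> 'M[R[i]]_m).
Hypotheses (detB : \det (matpoly n B) != 0) (detBn : \det (B n) != 0).

Let rev_shift :
  \det (matpoly n (revcoef B)) * 'X^(size (eigenvalues n B))
  = 'X^(m * n) * (lead_coef (\det (matpoly n B)) *: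
       \prod_(z <- eigenvalues n B) (1 - z *: 'X)).
Proof.
apply: poly_eq_off0 => x x0; rewrite !hornerM det_matpoly_rev_horner //.
rewrite !hornerXn hornerZ [in LHS]eigenvaluesE hornerZ -!mulrA; congr (_ * _).
congr (_ * _); rewrite !horner_prod.
elim: (eigenvalues n B) => [|z s IHs]; first by rewrite !big_nil mulr1.
rewrite !big_cons -IHs exprS mulrACA; congr (_ * _).
by rewrite !hornerE mulrBl mulVf.
Qed.

Let rev0 : (\det (matpoly n (revcoef B))).[0] != 0.
Proof.
rewrite det_matpoly_horner big_ord_recl big1 ?addr0.
  by rewrite expr0 scale1r /revcoef subn0.
by move=> i _; rewrite expr0n scale0r.
Qed.

Let prod0 : (lead_coef (\det (matpoly n B)) *:
       \prod_(z <- eigenvalues n B) (1 - z *: 'X)).[0] != 0.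
Proof.
rewrite hornerZ horner_prod big1 ?mulr1 ?lead_coef_eq0 // => z _.
by rewrite !hornerE ?mulr0 ?subr0.
Qed.

(** All m n eigenvalues are finite.  In the identity rev_shift the cofactors of
    the two powers of 'X do not vanish at 0, so that the powers agree. *)
Lemma size_eigenvalues : size (eigenvalues n B) = (m * n)%N.
Proof.
have nzX k : 'X^k != 0 :> {poly R[i]} by rewrite -size_poly_eq0 size_polyXn.
have [lt|gt|//] := ltngtP (size (eigenvalues n B)) (m * n)%N.
  move: rev_shift; rewrite -(subnK (ltnW lt)) exprD mulrAC => /(mulIf (nzX _)).
  move/(congr1 (horner^~ 0)); rewrite hornerM hornerXn expr0n.
  by rewrite subn_eq0 leqNgt lt mul0r => /eqP; rewrite (negPf rev0).
move: rev_shift; rewrite -{1}(subnK (ltnW gt)) exprD mulrA mulrC => /(mulfI (nzX _)).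
move/(congr1 (horner^~ 0)); rewrite hornerM hornerXn expr0n.
by rewrite subn_eq0 leqNgt gt mulr0 => /esym/eqP; rewrite (negPf prod0).
Qed.

Lemma det_matpoly_rev :
  \det (matpoly n (revcoef B)) = lead_coef (\det (matpoly n B)) *:
       \prod_(z <- eigenvalues n B) (1 - z *: 'X).
Proof.
have nzX k : 'X^k != 0 :> {poly R[i]} by rewrite -size_poly_eq0 size_polyXn.
by move: rev_shift; rewrite size_eigenvalues mulrC => /(mulfI (nzX _)).
Qed.

End Spectrum.

Lemma scaled_unitary_rev B sigma S : scaled_unitary n B sigma S ->
  scaled_unitary n (revcoef B) (revcoef sigma) (revcoef S).
Proof. by move=> dec i _; apply: dec; exact: leq_subr. Qed.

Lemma scaled_unitary_det_neq0 B sigma S i : scaled_unitary n B sigma S ->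
  (i <= n)%N -> 0 < sigma i -> \det (B i) != 0.
Proof.
move=> dec /dec[_ Si ->] si; rewrite detZ mulf_neq0 //.
  by rewrite expf_neq0 // gt_eqF // ltcR.
have /(congr1 determinant) := Si; rewrite det_mulmx det1 => SS.
by apply/eqP => S0; move/eqP: SS; rewrite S0 mulr0 eq_sym oner_eq0.
Qed.

Variables (B S : nat -> 'M[R[i]]_m) (sigma : nat -> R) (k : nat) (r : R).
Hypotheses (dec : scaled_unitary n B sigma S) (detB : \det (matpoly n B) != 0).
Hypotheses (r0 : 0 < r)
  (dom : \sum_(i < n.+1 | (i : nat) != k) sigma i * r ^+ i <= sigma k * r ^+ k).

Lemma count_eigenvalues_lt : (k < n)%N -> 0 < sigma n ->
  (count (fun z => (`|z| < r%:C)%R) (eigenvalues n B) <= m * k)%N.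
Proof.
move=> kn sn; rewrite -size_filter.
apply: (interior_eigenvalues_le dec kn sn r0 dom).
  by move=> z; rewrite mem_filter => /andP[].
rewrite [X in _ %| X]eigenvaluesE dvdpZr ?lead_coef_eq0 // big_filter.
by rewrite [X in _ %| X](bigID (fun z => `|z| < r%:C)) /= dvdp_mulIl.
Qed.

(** The counterpart outside the disc, by reversal of the coefficients: the
    inverses of the eigenvalues outside the disc of radius r are eigenvalues of
    the reversed polynomial, inside the disc of radius 1 / r. *)
Lemma count_eigenvalues_gt : (0 < k <= n)%N -> 0 < sigma 0%N -> 0 < sigma n ->
  (count (fun z => (r%:C < `|z|)%R) (eigenvalues n B) <= m * (n - k))%N.
Proof.
move=> /andP[k0 kn] s0 sn.
have detBn := scaled_unitary_det_neq0 dec (leqnn n) sn.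
pose zs := [seq z^-1 | z <- eigenvalues n B & (r%:C < `|z|)%R].
have <- : size zs = count (fun z => (r%:C < `|z|)%R) (eigenvalues n B).
  by rewrite size_map size_filter.
have rC0 : 0 < r%:C by rewrite ltcR.
apply: (interior_eigenvalues_le (scaled_unitary_rev dec) (r := r^-1)).
- by rewrite -subn_gt0 subKn.
- by rewrite /revcoef subnn.
- by rewrite invr_gt0.
- rewrite -(ler_pM2r (exprn_gt0 n r0)) mulr_suml /revcoef subKn //.
  have rX i : (i <= n)%N -> r^-1 ^+ i * r ^+ n = r ^+ (n - i).
    move=> le_in; rewrite -{1}(subnK le_in) exprD exprVn mulrC mulfK //.
    by rewrite expf_neq0 // gt_eqF.
  rewrite -mulrA rX ?leq_subr // subKn //; apply: le_trans dom.
  rewrite (reindex_inj rev_ord_inj) /= le_eqVlt; apply/orP; left; apply/eqP.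
  apply: eq_big => [i|i _].
    by rewrite subSS; have := ltn_ord i; rewrite ltnS => ?; rewrite eqn_sub2lE.
  have le_in : (i <= n)%N by rewrite -ltnS.
  by rewrite subSS -mulrA rX ?leq_subr // subKn.
- move=> y /mapP[z]; rewrite mem_filter => /andP[rz _] ->.
  by rewrite normfV fmorphV /= ltf_pV2 ?posrE // (lt_trans rC0).
rewrite det_matpoly_rev // dvdpZr ?lead_coef_eq0 // big_map big_filter.
rewrite [X in _ %| X](bigID (fun z => (r%:C < `|z|)%R)) /=.
apply: dvdp_mulr; elim/big_rec2: _ => // z p q rz qp.
have z0 : z != 0 by rewrite -normr_gt0 (lt_trans rC0).
apply: dvdp_mul => //.
have -> : 1 - z *: 'X = - z *: ('X - z^-1%:P).
  by rewrite scalerBr scale_polyC mulNr mulfV // rmorphN1 opprK scaleNr addrC.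
by rewrite dvdpZr // oppr_eq0.
Qed.

End Reversal.

(** * The indices and radii of the scalar polynomial *)

Section PelletIndices.
Variables (n : nat) (R : realType) (sigma : nat -> R).

Lemma pellet_hE k : (k \in pellet_h n sigma) =
  (k <= n)%N && [|| k == 0, k == n | pellet_count n sigma k == 2]%N.
Proof. by rewrite mem_filter mem_iota add0n ltnS leq0n andbC. Qed.

Lemma pellet_h_nth0 : nth 0%N (pellet_h n sigma) 0 = 0%N.
Proof. by []. Qed.

Lemma size_pellet_h : size (pellet_h n sigma) = (pellet_p n sigma).+1.
Proof. by []. Qed.

Lemma pellet_h_nth_last : nth 0%N (pellet_h n sigma) (pellet_p n sigma) = n.
Proof.
rewrite nth_last /pellet_h -[n.+1]addn1 iotaD filter_cat last_cat /= add0n.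
by rewrite eqxx orbT.
Qed.

Lemma pellet_h_nth_in i : (i <= pellet_p n sigma)%N ->
  nth 0%N (pellet_h n sigma) i \in pellet_h n sigma.
Proof. by move=> ip; apply: mem_nth; rewrite size_pellet_h ltnS. Qed.

Lemma pellet_h_nth_lt i : (0 < i <= pellet_p n sigma)%N ->
  (nth 0 (pellet_h n sigma) i.-1 < nth 0 (pellet_h n sigma) i)%N.
Proof.
case: i => // i /andP[_ ip]; apply: (sorted_ltn_nth ltn_trans) => //.
- by apply: sorted_filter (iota_ltn_sorted _ _); exact: ltn_trans.
- by rewrite inE size_pellet_h ltnS ltnW.
Qed.

End PelletIndices.

Section PelletRoots.
Variables (R : realType) (n : nat) (sigma : nat -> R).
Hypotheses (sge0 : forall i, (i <= n)%N -> 0 <= sigma i)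
           (s0 : 0 < sigma 0%N) (sn : 0 < sigma n) (n0 : (0 < n)%N).

Lemma pellet_poly_horner k x : (pellet_poly n sigma k).[x] =
  sigma k * x ^+ k - \sum_(i < n.+1 | (i : nat) != k) sigma i * x ^+ i.
Proof.
rewrite /pellet_poly !hornerE horner_sum; congr (_ - _).
by apply: eq_bigr => i _; rewrite !hornerE.
Qed.

Lemma pellet_poly_horner0 k : (pellet_poly n sigma k).[0] =
  if k == 0%N then sigma 0%N else - sigma 0%N.
Proof.
rewrite pellet_poly_horner expr0n big_mkcond big_ord_recl big1 => [|i _].
  case: k => [|k] /=; rewrite ?addr0 ?expr0 ?mulr1 ?mulr0 ?subr0 ?sub0r //.
by rewrite expr0n mulr0 if_same.
Qed.

Lemma pellet_poly_horner0_neq0 k : (pellet_poly n sigma k).[0] != 0.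
Proof. by rewrite pellet_poly_horner0; case: ifP => _; rewrite ?oppr_eq0 gt_eqF. Qed.

Lemma pellet_poly_neq0 k : pellet_poly n sigma k != 0.
Proof.
apply: contraNneq (pellet_poly_horner0_neq0 k) => ->; by rewrite horner0.
Qed.

Lemma pellet_rootsP k x : x \in pellet_roots n sigma k -> 0 < x /\
  sigma k * x ^+ k = \sum_(i < n.+1 | (i : nat) != k) sigma i * x ^+ i.
Proof.
by rewrite mem_pellet_roots ?pellet_poly_neq0 // => /andP[x0 /eqP].
Qed.

(** A sign change on [0, b] yields a positive solution. *)
Lemma pellet_roots_ivt k b : 0 <= b ->
  (pellet_poly n sigma k).[0] * (pellet_poly n sigma k).[b] <= 0 ->
  pellet_roots n sigma k != [::].
Proof.
move=> b0 /(polyrcf.poly_ivt b0)[x /itvP x0b rx].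
have x0 : 0 < x.
  rewrite lt_def x0b andbT; apply: contraTneq rx => ->.
  exact: pellet_poly_horner0_neq0.
suff: x \in pellet_roots n sigma k by case: pellet_roots.
rewrite mem_pellet_roots ?pellet_poly_neq0 // x0 -subr_eq0.
by rewrite -pellet_poly_horner; exact: rx.
Qed.

Lemma pellet_roots0 : pellet_roots n sigma 0 != [::].
Proof.
have q0 : 0 <= sigma 0%N / sigma n by rewrite divr_ge0 // ltW.
(* b >= 1, so that sigma_n b ^ n >= sigma_n b >= sigma_0 *)
pose b := 1 + sigma 0%N / sigma n.
have b1 : 1 <= b by rewrite lerDl.
have b0 : 0 <= b by exact: le_trans b1.
apply: (pellet_roots_ivt b0).
rewrite pellet_poly_horner0 /= pmulr_rle0 // pellet_poly_horner expr0 mulr1.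
rewrite subr_le0 (bigD1 ord_max) /=; last by rewrite -lt0n.
rewrite -[leLHS]addr0 lerD //; last first.
  apply: sumr_ge0 => i _; rewrite mulr_ge0 ?exprn_ge0 // sge0 //.
  by rewrite -ltnS.
rewrite -ler_pdivrMl // mulrC; apply: le_trans (ler_eXnr n0 b1).
by rewrite lerDr.
Qed.

Lemma pellet_rootsn : pellet_roots n sigma n != [::].
Proof.
pose c := \sum_(i < n.+1 | (i : nat) != n) sigma i.
have c0 : 0 <= c.
  by apply: sumr_ge0 => i _; rewrite sge0 // -ltnS.
have q0 : 0 <= c / sigma n by rewrite divr_ge0 // ltW.
(* b >= 1, so that the terms of index i < n sum to at most c b ^ (n - 1) *)
pose b := 1 + c / sigma n.
have b1 : 1 <= b by rewrite lerDl.
have b0 : 0 <= b by exact: le_trans b1.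
apply: (pellet_roots_ivt b0).
rewrite pellet_poly_horner0 -[n == 0%N]negbK -lt0n n0 /= mulNr oppr_le0.
rewrite pmulr_rge0 // pellet_poly_horner subr_ge0.
apply: (@le_trans _ _ (c * b ^+ n.-1)).
  rewrite mulr_suml ler_sum // => i ni; have := ltn_ord i; rewrite ltnS => le_in.
  rewrite ler_wpM2l ?sge0 // ler_weXn2l // -ltnS prednK //.
  by rewrite ltn_neqAle ni.
have -> : b ^+ n = b * b ^+ n.-1 by rewrite -exprS prednK.
rewrite mulrA ler_wpM2r ?exprn_ge0 //.
by rewrite mulrDr mulr1 mulrCA mulfV ?gt_eqF // mulr1 lerDr ltW.
Qed.

Lemma pellet_roots_neq0 k : k \in pellet_h n sigma ->
  pellet_roots n sigma k != [::].
Proof.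
rewrite pellet_hE => /andP[_ /or3P[/eqP->|/eqP->|]].
- exact: pellet_roots0.
- exact: pellet_rootsn.
by rewrite /pellet_count; case: pellet_roots => //; rewrite big_nil.
Qed.

End PelletRoots.

(** * Slicing and counting in sorted sequences *)

Section SortedCounting.
Variables (T : Type) (x0 : T).

(** Cutting s at the positions g 0 = 0 <= g 1 <= ... <= g p and gluing the pieces
    gives back the first g p entries. *)
Lemma flatten_slices (s : seq T) (g : nat -> nat) p :
  g 0%N = 0%N -> (forall i, (0 < i <= p)%N -> (g i.-1 <= g i)%N) ->
  flatten [seq take (g i - g i.-1) (drop (g i.-1) s) | i <- iota 1 p]
    = take (g p) s.
Proof.
move=> g0; elim: p => [|p IHp] gP; first by rewrite g0 take0.
rewrite -[p.+1]addn1 iotaD map_cat flatten_cat IHp => [|i /andP[i0 ip]]; last first.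
  by rewrite gP // i0 leqW.
rewrite /= cats0 add1n addn1 add0n -takeD subnKC //.
by apply: (gP p.+1); rewrite /= leqnn.
Qed.

(** In a sorted sequence, a downward closed predicate holds exactly on the
    initial segment whose length is the number of entries that satisfy it. *)
Lemma sorted_down_nth (leT : rel T) (D : pred T) (s : seq T) j :
  transitive leT -> reflexive leT ->
  (forall x y, leT x y -> D y -> D x) -> sorted leT s -> (j < size s)%N ->
  D (nth x0 s j) = (j < count D s)%N.
Proof.
move=> trT reflT downD srt js; apply/idP/idP => [Dj|].
  rewrite -[s](cat_take_drop j.+1) count_cat ltn_addr //.
  have /eqP -> : count D (take j.+1 s) == size (take j.+1 s).
    rewrite -all_count; apply/(all_nthP x0) => i.
    rewrite size_takel // => ij; rewrite nth_take //; apply: downD Dj.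
    by apply: sorted_leq_nth; rewrite ?inE // (leq_ltn_trans _ js).
  by rewrite size_takel.
apply: contraTT => nDj; rewrite -leqNgt.
rewrite -[s](cat_take_drop j) count_cat.
have /eqP -> : count D (drop j s) == 0%N.
  rewrite -leqn0 leqNgt -has_count -all_predC; apply/(all_nthP x0) => i.
  rewrite size_drop ltn_subRL nth_drop => ijs; apply: contra nDj.
  by apply: downD; apply: sorted_leq_nth; rewrite ?inE ?leq_addr.
by rewrite addn0 (leq_trans (count_size _ _)) // size_take_min geq_minl.
Qed.

End SortedCounting.

Lemma count_addb (T : Type) (a1 a2 a3 : pred T) (s : seq T) :
  (forall x, a1 x + a2 x = a3 x :> nat)%N ->
  (count a1 s + count a2 s = count a3 s)%N.
Proof. by move=> aE; elim: s => //= x s <-; rewrite -aE addnACA. Qed.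

Lemma count_sub_lt (T : eqType) (a1 a2 : pred T) (s : seq T) x :
  subpred a1 a2 -> x \in s -> ~~ a1 x -> a2 x -> (count a1 s < count a2 s)%N.
Proof.
move=> sub12 /splitPr[s1 s2] a1x a2x; rewrite !count_cat /= (negPf a1x) a2x.
by rewrite add0n add1n addnS ltnS leq_add // sub_count.
Qed.

(** * Localisation of the eigenvalues *)

Section Counting.
Variables (R : realType) (m n : nat) (B S : nat -> 'M[R[i]]_m) (sigma : nat -> R).
Hypotheses (BQ : matpolyQ n B) (dec : scaled_unitary n B sigma S).

Lemma matpolyQ_weight_gt0 i : (i <= n)%N -> B i != 0 -> 0 < sigma i.
Proof.
move=> /dec[si _ Bi]; apply: contraNT; rewrite -leNgt => si0.
have /eqP si_eq0 : sigma i == 0 by rewrite eq_le si0.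
by rewrite Bi si_eq0 scale0r.
Qed.

(** The two inequalities behind all three conclusions.  Only the equality
    sigma_k x ^ k = sum_(i != k) sigma_i x ^ i at x = s_k and x = t_k is used, so
    that a double solution s_k = t_k needs no separate treatment. *)
Lemma count_pellet k : k \in pellet_h n sigma ->
  (count (fun z => ((complex.Re `|z|)%:E < pellet_t n sigma k)%E) (eigenvalues n B)
     <= m * k
     <= count (fun z => ((complex.Re `|z|)%:E <= pellet_s n sigma k)%E)
          (eigenvalues n B))%N.
Proof.
move=> kh; have [[detB Bn B0] _] := BQ.
have sn := matpolyQ_weight_gt0 (leqnn n) Bn.
have s0 := matpolyQ_weight_gt0 (leq0n n) B0.
have sge0 i : (i <= n)%N -> 0 <= sigma i by case/dec.
have kn : (k <= n)%N by move: kh; rewrite pellet_hE => /andP[].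
have detBn := scaled_unitary_det_neq0 dec (leqnn n) sn.
have szE := size_eigenvalues detB detBn.
have modE (z : R[i]) : `|z| = (Normc.normc z)%:C by [].
apply/andP; split.
  rewrite /pellet_t; have [->|k_n] := eqVneq k n.
    by rewrite -szE count_size.
  have kn' : (k < n)%N by rewrite ltn_neqAle k_n.
  have n0 : (0 < n)%N by exact: leq_ltn_trans kn'.
  have nz := pellet_roots_neq0 sge0 s0 sn n0 kh.
  have [|r0 dom] := @pellet_rootsP _ n _ s0 k (last 0 (pellet_roots n sigma k)).
    by case: pellet_roots nz => //= x s _; rewrite mem_last.
  apply: leq_trans (count_eigenvalues_lt dec detB r0 _ kn' sn); last by rewrite dom.
  by apply: sub_count => z /=; rewrite lte_fin modE ltcR.
rewrite /pellet_s; have [->|k_0] := eqVneq k 0%N; first by rewrite muln0.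
have k0 : (0 < k)%N by rewrite lt0n.
have n0 : (0 < n)%N by exact: leq_trans kn.
have nz := pellet_roots_neq0 sge0 s0 sn n0 kh.
have [|r0 dom] := @pellet_rootsP _ n _ s0 k (head 0 (pellet_roots n sigma k)).
  by case: pellet_roots nz => //= x s _; rewrite mem_head.
set r := head _ _ in r0 dom *.
have gt_le : (count (fun z => (r%:C < `|z|)%R) (eigenvalues n B) <= m * (n - k))%N.
  by apply: (count_eigenvalues_gt dec detB r0 _ _ s0 sn); rewrite ?dom ?k0.
have := count_predC (fun z : R[i] => (r%:C < `|z|)%R) (eigenvalues n B).
rewrite szE => cnt; rewrite -(leq_add2l (m * (n - k))) -mulnDr subnK // -cnt.
rewrite leq_add //; apply: sub_count => z /=.
by rewrite lee_fin modE ltcR -leNgt.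
Qed.

End Counting.

Lemma annulusE (R : realType) (a b : \bar R) (z : R[i]) :
  annulus a b z = (a <= (complex.Re `|z|)%:E)%E && ((complex.Re `|z|)%:E <= b)%E.
Proof. by []. Qed.



Theorem theorem2p3 (R : realType) (m n : nat)
    (A : nat -> 'M[R[i]]_m) (sigma : nat -> R) (Q : nat -> 'M[R[i]]_m)
    (AQ : matpolyQ n A) (A_dec : scaled_unitary n A sigma Q)
    (B S : nat -> 'M[R[i]]_m)
    (BQ : matpolyQ n B) (B_dec : scaled_unitary n B sigma S) :
  let h := nth 0%N (pellet_h n sigma) in
  let p := pellet_p n sigma in
  let s := pellet_s n sigma in
  let t := pellet_t n sigma in
  [/\ (* m (h_i - h_(i-1)) eigenvalues in each annulus: the eigenvalues,
         listed with multiplicity, split into groups of these sizes, the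
         i-th one lying in the i-th annulus; consecutive closed annuli may
         share a circle, when s_(h_i) = t_(h_i) *)
      exists E : nat -> seq R[i],
        perm_eq (eigenvalues n B) (flatten [seq E i | i <- iota 1 p]) /\
        forall i, (0 < i <= p)%N ->
          size (E i) = (m * (h i - h i.-1))%N /\
          {in E i, forall z, annulus (t (h i.-1)) (s (h i)) z},
      (* without such a circle on its boundary, the annulus contains
         exactly that many eigenvalues *)
      forall i, (0 < i <= p)%N ->
        (s (h i.-1) < t (h i.-1))%E -> (s (h i) < t (h i))%E ->
        count (annulus (t (h i.-1)) (s (h i))) (eigenvalues n B)
          = (m * (h i - h i.-1))%N
    & forall i, (i <= p)%N ->
        {in eigenvalues n B, forall z, ~~ inner_annulus (s (h i)) (t (h i)) z}].


Proof.
move=> h p s t.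
set es := eigenvalues n B.
(* The groups are the consecutive slices of the list sorted by modulus. *)
pose le_mod := relpre (fun z : R[i] => complex.Re `|z|) <=%R.
have le_trans_mod : transitive le_mod by move=> y x z; exact: le_trans.
have le_refl_mod : reflexive le_mod by move=> x; exact: lexx.
have le_total_mod : total le_mod by move=> x y; exact: le_total.
pose L := sort le_mod es.
have srtL : sorted le_mod L by exact: sort_sorted.
have permL : perm_eq es L by rewrite perm_sym perm_sort.
have [[detB Bn B0] _] := BQ.
have sn := matpolyQ_weight_gt0 B_dec (leqnn n) Bn.
have detBn := scaled_unitary_det_neq0 B_dec (leqnn n) sn.
have szL : size L = (m * n)%N by rewrite size_sort size_eigenvalues.
have m0 : (0 < m)%N.
  rewrite lt0n; apply: contraNneq Bn => m_eq0; apply/eqP/matrixP => a.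
  by have := ltn_ord a; rewrite {2}m_eq0.
have cnt i : (i <= p)%N ->
    (count (fun z => ((complex.Re `|z|)%:E < t (h i))%E) es <= m * h i)%N /\
    (m * h i <= count (fun z => ((complex.Re `|z|)%:E <= s (h i))%E) es)%N.
  by move=> ip; have /andP[] := count_pellet BQ B_dec (pellet_h_nth_in ip).
have h_lt i : (0 < i <= p)%N -> (h i.-1 < h i)%N by exact: pellet_h_nth_lt.
have lt_down (a : \bar R) x y : le_mod x y ->
    ((complex.Re `|y|)%:E < a)%E -> ((complex.Re `|x|)%:E < a)%E.
  by move=> xy; apply: le_lt_trans; rewrite lee_fin.
have le_down (a : \bar R) x y : le_mod x y ->
    ((complex.Re `|y|)%:E <= a)%E -> ((complex.Re `|x|)%:E <= a)%E.
  by move=> xy; apply: le_trans; rewrite lee_fin.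
split.
- exists (fun i => take (m * h i - m * h i.-1) (drop (m * h i.-1) L)); split.
    rewrite (@flatten_slices _ L (fun i => m * h i)%N p); first last.
    + by move=> i ip; rewrite leq_mul2l ltnW ?orbT ?h_lt.
    + by rewrite /h pellet_h_nth0 muln0.
    by rewrite /h pellet_h_nth_last take_oversize ?szL.
  move=> i ip; have [i0 le_ip] := andP ip.
  have hi_n : (h i <= n)%N.
    by have := pellet_h_nth_in le_ip; rewrite pellet_hE => /andP[].
  have i1p : (i.-1 <= p)%N by exact: leq_trans (leq_pred _) le_ip.
  have mh : (m * h i.-1 <= m * h i)%N by rewrite leq_mul2l ltnW ?orbT ?h_lt.
  have mhn : (m * h i <= size L)%N by rewrite szL leq_mul2l hi_n orbT.
  have sz_slice : size (take (m * h i - m * h i.-1) (drop (m * h i.-1) L))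
      = (m * h i - m * h i.-1)%N.
    by rewrite size_takel // size_drop leq_sub2r.
  split; first by rewrite sz_slice mulnBr.
  move=> z /(nthP 0)[j]; rewrite sz_slice => j_lt <-.
  rewrite nth_take // nth_drop; set l := (_ + j)%N.
  have l_lt : (l < m * h i)%N by rewrite -ltn_subRL.
  have l_szL : (l < size L)%N by exact: leq_trans mhn.
  rewrite annulusE; apply/andP; split.
    rewrite leNgt.
    rewrite (sorted_down_nth 0 le_trans_mod le_refl_mod (@lt_down (t (h i.-1))) srtL l_szL).
    rewrite -leqNgt -(seq.permP permL).
    by rewrite (leq_trans (cnt _ i1p).1) // leq_addr.
  rewrite (sorted_down_nth 0 le_trans_mod le_refl_mod (@le_down (s (h i))) srtL l_szL).
  by rewrite -(seq.permP permL) (leq_trans l_lt) // (cnt _ le_ip).2.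
- move=> i ip st1 st2; have [i0 le_ip] := andP ip.
  have i1p : (i.-1 <= p)%N by exact: leq_trans (leq_pred _) le_ip.
  have [c1 c2] := cnt _ i1p; have [c3 c4] := cnt _ le_ip.
  have ge_t : count (fun z => ((complex.Re `|z|)%:E < t (h i.-1))%E) es = (m * h i.-1)%N.
    apply/eqP; rewrite eqn_leq c1 (leq_trans c2) //.
    by apply: sub_count => z /= /le_lt_trans; apply.
  have le_s : count (fun z => ((complex.Re `|z|)%:E <= s (h i))%E) es = (m * h i)%N.
    apply/eqP; rewrite eqn_leq c4 andbT (leq_trans _ c3) //.
    by apply: sub_count => z /= /le_lt_trans; apply.
  have ts : (t (h i.-1) <= s (h i))%E.
    rewrite leNgt; apply/negP => st.
    have : (m * h i <= m * h i.-1)%N.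
      by rewrite -ge_t -le_s; apply: sub_count => z /= /le_lt_trans; apply.
    by rewrite leq_pmul2l // leqNgt h_lt.
  apply/eqP; rewrite mulnBr -le_s -ge_t.
  rewrite -(eqn_add2r (count (fun z => ((complex.Re `|z|)%:E < t (h i.-1))%E) es)).
  rewrite subnK; last first.
    by apply: sub_count => z /= zt; exact: le_trans (ltW zt) ts.
  apply/eqP/count_addb => z; rewrite annulusE.
  case: (leP (t (h i.-1)) (complex.Re `|z|)%:E) => //= zt; first by rewrite addn0.
  by rewrite (le_trans (ltW zt) ts).
move=> i ip z zes; apply/negP => /andP[sz zt].
have [c1 c2] := cnt _ ip.
have := leq_trans c1 c2; rewrite leqNgt => /negP[].
apply: (count_sub_lt _ zes); rewrite -?ltNge //.
by move=> x /= xs; apply: le_lt_trans xs (lt_trans sz zt).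
Qed.
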